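(* Let $\Gamma$ and $\Gamma'$ be coprime splice diagrams satisfying the edge determinant and semigroup conditions whose leaves are both identified with the same index set $\{1,\dots,n\}$, and suppose that all tropical multiplicities of their splice fans equal one. If the splice fans $\mathbb{R}_{\ge0}\rho_\Gamma(\Gamma)$ and $\mathbb{R}_{\ge0}\rho_{\Gamma'}(\Gamma')$ in $\mathbb{R}^n$ coincide, then $\Gamma=\Gamma'$, i.e., they are isomorphic as trees via an isomorphism respecting the leaf labels and all weights. In other words, the coprime splice diagram yielding a given splice fan with all tropical multiplicities one is unique.
   Context: A splice diagram is a finite tree $\Gamma$ with at least one vertex of valency $\geq3$ and no vertex of valency $2$; vertices of valency $1$ are leaves, others nodes; $\delta_v$ is the valency of $v$. For each node $v$ and edge $e$ at $v$ a positive integer weight $d_{v,e}$ is given; $\Gamma$ is coprime if the weights around each node are pairwise coprime. $d_v=\prod_{e\ni v}d_{v,e}$; $d_{v,u}$ is the weight at $v$ of the edge toward $u$. For distinct vertices $u,v$, $\ell_{u,v}$ is the product of all $d_{w,e}$ with $w$ a node on $[u,v]$ and $e$ an edge at $w$ not in $[u,v]$; $\ell_{v,v}=d_v$. Edge determinant condition: $d_{u,v}d_{v,u}>\ell_{u,v}$ for every edge between nodes. Semigroup condition: for each node $v$ and edge $e$ at $v$, $d_v\in\sum_{\lambda\in L(v,e)}\mathbb{N}\ell_{v,\lambda}$, $L(v,e)$ the leaves $\lambda$ with $e\subseteq[v,\lambda]$. Standard basis vectors $w_\lambda$ of $\mathbb{R}^n$ are indexed by leaves; $w_u=\sum_\lambda\ell_{u,\lambda}w_\lambda$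 for nodes $u$; $\rho_\Gamma$ sends each vertex $u$ to $w_u/|w_u|$ ($1$-norm), affinely on edges; the splice fan is $\mathbb{R}_{\ge0}\rho_\Gamma(\Gamma)$ with two-dimensional cones $\mathbb{R}_{\ge0}\rho_\Gamma([u,v])$ for edges $[u,v]$. A splice type system for $\Gamma$ is a family $F_{v,i}=f_{v,i}+g_{v,i}\in\mathbb{C}\{z_\lambda\}$ ($v$ node, $1\le i\le\delta_v-2$), $f_{v,i}=\sum_{e\ni v}c_{v,e,i}\prod_\lambda z_\lambda^{\alpha_{v,e,\lambda}}$ with $\alpha_{v,e,\lambda}\in\mathbb{N}$, $\lambda\in L(v,e)$, $d_v=\sum\alpha_{v,e,\lambda}\ell_{v,\lambda}$, all maximal minors of $(c_{v,e,i})_{e,i}$ nonzero, and $g_{v,i}$ convergent with every exponent $m$ satisfying $w_v\cdot m>d_v$ and $w_u\cdot m>\ell_{u,v}$ for nodes $u\ne v$. For $w\in\mathbb{R}_{>0}^n$ let $Z_w\subseteq\mathbb{C}^n$ be defined by the $w$-initial forms (sums of terms of minimal $w$-weight) of all elements of the ideal generated by the system; the tropical multiplicity of a two-dimensional cone $\sigma$ of the splice fan is the number of irreducible components, counted with multiplicity, of $Z_w\cap(\mathbb{C}^* )^n$ for $w$ in the relative interior of $\sigma$. *)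

(* Defs.v *)
From HB Require Import structures.
From mathcomp Require Import all_boot all_order all_algebra.
From mathcomp Require Import reals.
From mathcomp Require Import complex.
From mathcomp Require Import mpoly.

Set Implicit Arguments.
Unset Strict Implicit.
Unset Printing Implicit Defensive.

Import Order.TTheory GRing.Theory Num.Theory.
Local Open Scope ring_scope.

(* sd_E is the adjacency relation of the tree; an edge e at a vertex v  *)
(* is identified with the neighbour u of v at the other end of e, so    *)
(* d_{v,e} is  sd_d v u.  sd_lab i is the leaf with label i.            *)
Record splice_diagram (n : nat) := SpliceDiagram {
  sd_V : finType;
  sd_E : rel sd_V;
  sd_lab : 'I_n -> sd_V;
  sd_d : sd_V -> sd_V -> nat }.
Arguments sd_V {n} s.
Arguments sd_E {n} s _ _.
Arguments sd_lab {n} s _.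
Arguments sd_d {n} s _ _.

Section SpliceDiagram.
Variables (n : nat) (G : splice_diagram n).
Local Notation V := (sd_V G).
Local Notation E := (sd_E G).
Local Notation lab := (sd_lab G).
Local Notation d := (sd_d G).

Definition sd_nbrs (v : V) : {set V} := [set u | E v u].
Definition sd_val (v : V) : nat := #|sd_nbrs v|.
Definition sd_node (v : V) : bool := (3 <= sd_val v)%N.
Definition sd_leaf (v : V) : bool := (sd_val v == 1)%N.

Definition sd_on_path (u v w : V) : bool :=
  [|| w == u, w == v |
      ~~ connect [rel x y | [&& E x y, x != w & y != w]] u v].

Definition is_splice_diagram : Prop :=
  [/\ ssrbool.symmetric E, irreflexive E,
      (forall u v : V, connect E u v),
      #|[set p : V * V | E p.1 p.2]| = (2 * (#|V| - 1))%N &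
   [/\ (forall v, sd_val v != 2%N), (exists v, sd_node v),
       injective lab, (forall v, sd_leaf v <-> exists i, lab i = v) &
       (forall v u, sd_node v -> E v u -> (0 < d v u)%N)]].

Definition sd_dv (v : V) : nat := \prod_(u in sd_nbrs v) d v u.

Definition sd_ell (u v : V) : nat :=
  if u == v then sd_dv u else
  \prod_(w | sd_node w && sd_on_path u v w)
     \prod_(x in sd_nbrs w | ~~ sd_on_path u v x) d w x.

Definition sd_coprime : Prop :=
  forall v u u', sd_node v -> E v u -> E v u' -> u != u' ->
    coprime (d v u) (d v u').

Definition sd_edge_det : Prop :=
  forall u v, sd_node u -> sd_node v -> E u v ->
    (sd_ell u v < d u v * d v u)%N.

Definition sd_in_L (v u : V) (i : 'I_n) : bool := sd_on_path v (lab i) u.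

Definition sd_semigroup : Prop :=
  forall v u, sd_node v -> E v u ->
    exists a : 'I_n -> nat,
      (forall i, ~~ sd_in_L v u i -> a i = 0%N) /\
      sd_dv v = (\sum_(i < n) a i * sd_ell v (lab i))%N.

Variable R : realType.

Definition sd_w (u : V) (i : 'I_n) : R :=
  if sd_node u then (sd_ell u (lab i))%:R else (lab i == u)%:R.

Definition sd_rho (u : V) (i : 'I_n) : R :=
  sd_w u i / \sum_(j < n) sd_w u j.

Definition in_splice_fan (x : 'I_n -> R) : Prop :=
  exists u v, E u v /\ exists t s : R,
    [/\ 0 <= t, 0 <= s, s <= 1 &
        forall i, x i = t * ((1 - s) * sd_rho u i + s * sd_rho v i)].

Definition series := 'X_{1..n} -> R[i].

Definition convergent (f : series) : Prop :=
  exists r : R, 0 < r /\ exists B : R,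
    forall m, `|f m| * (Complex r 0) ^+ mdeg m <= Complex B 0.

Definition smul (f g : series) : series := fun m =>
  \sum_(m1 : 'X_{1..n < (mdeg m).+1} | (m1 <= m)%MM) f m1 * g (m - m1)%MM.

Definition wdot (u : V) (m : 'X_{1..n}) : nat :=
  (\sum_(i < n) sd_ell u (lab i) * m i)%N.

Definition sts_F (c : V -> V -> nat -> R[i]) (alpha : V -> V -> 'X_{1..n})
  (g : V -> nat -> series) (v : V) (i : nat) : series := fun m =>
  \sum_(u in sd_nbrs v) c v u i * (m == alpha v u)%:R + g v i m.

Definition is_splice_system (c : V -> V -> nat -> R[i])
  (alpha : V -> V -> 'X_{1..n}) (g : V -> nat -> series) : Prop :=
  [/\ (forall v u, sd_node v -> E v u ->
         (forall i, ~~ sd_in_L v u i -> alpha v u i = 0%N) /\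
         sd_dv v = (\sum_(i < n) alpha v u i * sd_ell v (lab i))%N),
      (forall v, sd_node v -> forall S : {set V},
         S \subset sd_nbrs v -> #|S| = (sd_val v - 2)%N ->
         \det (\matrix_(a < sd_val v - 2, b < sd_val v - 2)
                 c v (nth v (enum S) a) b) != 0) &
      (forall v i, sd_node v -> (i < sd_val v - 2)%N ->
         convergent (g v i) /\
         forall m, g v i m != 0 ->
           (sd_dv v < wdot v m)%N /\
           forall u, sd_node u -> u != v -> (sd_ell u v < wdot u m)%N)].

Definition in_sts_ideal c alpha g (h : series) : Prop :=
  exists (k : nat) (vs : 'I_k -> V) (ix : 'I_k -> nat) (hs : 'I_k -> series),
    (forall j, [/\ sd_node (vs j), (ix j < sd_val (vs j) - 2)%N &
                   convergent (hs j)]) /\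
    forall m, h m = \sum_(j < k) smul (hs j) (sts_F c alpha g (vs j) (ix j)) m.

End SpliceDiagram.

Section Tropical.
Variables (R : realType) (n : nat).
Local Notation C := R[i].
Local Notation A := {mpoly C[n]}.

Definition wt (w : 'I_n -> R) (m : 'X_{1..n}) : R := \sum_(i < n) w i * (m i)%:R.

Definition is_initial_form (w : 'I_n -> R) (h : series n R) (p : A) : Prop :=
  ((forall m, h m = 0) /\ p = 0) \/
  exists mu : R,
    [/\ (exists m, h m != 0 /\ wt w m = mu),
        (forall m, h m != 0 -> mu <= wt w m) &
        forall m, p@_m = if wt w m == mu then h m else 0].

Definition initial_ideal (I : series n R -> Prop) (w : 'I_n -> R) (p : A) : Prop :=
  exists (k : nat) (qs ps : 'I_k -> A),
    (forall j, exists h, I h /\ is_initial_form w h (ps j)) /\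
    p = \sum_(j < k) qs j * ps j.

Definition is_ideal (S : A -> Prop) : Prop :=
  [/\ S 0, (forall a b, S a -> S b -> S (a + b)) &
      (forall a b, S b -> S (a * b))].

Definition is_prime_ideal (P : A -> Prop) : Prop :=
  [/\ is_ideal P, ~ P 1 & forall a b, P (a * b) -> P a \/ P b].

Definition psubset (S T : A -> Prop) : Prop := forall a, S a -> T a.

Definition minimal_prime_over (J P : A -> Prop) : Prop :=
  [/\ is_prime_ideal P, psubset J P &
      forall Q, is_prime_ideal Q -> psubset J Q -> psubset Q P -> psubset P Q].

(* minimal primes of J not containing z_1...z_n: irreducible components of
   V(J) meeting the torus (C^* )^n *)
Definition torus_component (J P : A -> Prop) : Prop :=
  minimal_prime_over J P /\ ~ P (\prod_(i < n) 'X_i).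

(* ideals of the localisation A_P correspond to P-saturated ideals of A *)
Definition P_saturated (P S : A -> Prop) : Prop :=
  forall s a, ~ P s -> S (s * a) -> S a.

(* strict chain of ideals of A_P of length k from J_P up to A_P *)
Definition has_local_chain (J P : A -> Prop) (k : nat) : Prop :=
  exists ch : nat -> A -> Prop,
    [/\ (forall j, (j <= k)%N -> is_ideal (ch j) /\ P_saturated P (ch j)),
        psubset J (ch 0%N), (forall a, ch k a) &
        forall j, (j < k)%N ->
          psubset (ch j) (ch j.+1) /\ exists a, ch j.+1 a /\ ~ ch j a].

(* length of (A/J)_P as A_P-module *)
Definition local_length (J P : A -> Prop) (k : nat) : Prop :=
  has_local_chain J P k /\ ~ has_local_chain J P k.+1.

Definition torus_mult (J : A -> Prop) (mu : nat) : Prop :=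
  exists (k : nat) (Ps : 'I_k -> A -> Prop) (ls : 'I_k -> nat),
    [/\ (forall j, torus_component J (Ps j) /\ local_length J (Ps j) (ls j)),
        (forall j j', (forall a, Ps j a <-> Ps j' a) -> j = j'),
        (forall P, torus_component J P -> exists j, forall a, P a <-> Ps j a) &
        (\sum_(j < k) ls j)%N = mu].

End Tropical.

Definition all_trop_mult_one (R : realType) (n : nat) (G : splice_diagram n) : Prop :=
  forall (c : sd_V G -> sd_V G -> nat -> R[i]) (alpha : sd_V G -> sd_V G -> 'X_{1..n})
    (g : sd_V G -> nat -> series n R), is_splice_system c alpha g ->
  forall u v, sd_E G u v ->
  forall t s : R, 0 < t -> 0 < s -> s < 1 ->
    let w := fun i => t * ((1 - s) * sd_rho R u i + s * sd_rho R v i) in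
    torus_mult (initial_ideal (in_sts_ideal c alpha g) w) 1.

Definition splice_iso (n : nat) (G G' : splice_diagram n) : Prop :=
  exists phi : sd_V G -> sd_V G',
    [/\ bijective phi,
        (forall x y, sd_E G' (phi x) (phi y) = sd_E G x y),
        (forall i, phi (sd_lab G i) = sd_lab G' i) &
        (forall v u, sd_node v -> sd_E G v u ->
           sd_d G' (phi v) (phi u) = sd_d G v u)].

(* Main.v *)
(* For a vertex u put wvec u = w_u, an integer vector. Along an edge xy the ratio
   wvec y / wvec x takes two values, the smaller one on the leaves on the side of x
   and the larger one on the side of y (this is the edge determinant condition).
   Hence for a node v and a node or neighbour u of v, the leaves where
   wvec u / wvec v is not minimal are those in the branch of v containing u, and for
   a point of the fan inside the cone over an edge only two branches can occur.
   So the fan determines the rays of the nodes and the partition of the leaves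
   into branches at each of them, hence the tree. By coprimality each wvec v is
   primitive, and the weight at v of the edge vu is the gcd of the coordinates of
   wvec v outside the branch of u. *)

Require Import Defs.
From HB Require Import structures.
From mathcomp Require Import all_boot all_order all_algebra.
From mathcomp Require Import reals.
From mathcomp Require Import complex.
From mathcomp Require Import mpoly.
From mathcomp Require Import zify ring lra.

Set Implicit Arguments.
Unset Strict Implicit.
Unset Printing Implicit Defensive.

Import Order.TTheory GRing.Theory Num.Theory.

(** * Distances in a finite tree *)

Section TreeDistance.
Variables (T : finType) (E : rel T).
Hypothesis Esym : ssrbool.symmetric E.
Hypothesis Econ : forall u v, connect E u v.

Definition walk (x y : T) (k : nat) : bool :=
  [exists t : k.-tuple T, path E x t && (last x t == y)].

Lemma walkP x y k :
  reflect (exists t, [/\ size t = k, path E x t & last x t = y]) (walk x y k).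
Proof.
apply: (iffP existsP) => [[t /andP[pt /eqP lt]]|[t [st pt lt]]].
  by exists t; rewrite size_tuple.
have st' : size t == k by apply/eqP.
by exists (Tuple st'); rewrite /= pt lt eqxx.
Qed.

Lemma walk_ex x y : exists k, walk x y k.
Proof.
have /connectP[t pt lt] := Econ x y.
by exists (size t); apply/walkP; exists t.
Qed.

(** Distances replace the paths defined by deleting vertices, so that statements about paths become
    arithmetic. *)
Definition dist (x y : T) : nat := ex_minn (walk_ex x y).

Lemma dist_walk x y : walk x y (dist x y).
Proof. by rewrite /dist; case: ex_minnP. Qed.

Lemma dist_min x y k : walk x y k -> dist x y <= k.
Proof. by rewrite /dist; case: ex_minnP => m _ + /[dup] => /[apply]. Qed.

Lemma dist_xx x : dist x x = 0.
Proof.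
by apply/eqP; rewrite -leqn0; apply/dist_min/walkP; exists [::].
Qed.

Lemma dist_eq0 x y : (dist x y == 0) = (x == y).
Proof.
apply/eqP/eqP => [d0|->]; last exact: dist_xx.
by have := dist_walk x y; rewrite d0 => /walkP[[|? ?] []].
Qed.

Lemma dist_triangle x y z : dist x z <= dist x y + dist y z.
Proof.
have /walkP[s [ss ps ls]] := dist_walk x y.
have /walkP[t [st pt lt]] := dist_walk y z.
apply/dist_min/walkP; exists (s ++ t).
by rewrite size_cat ss st cat_path ps ls pt last_cat ls lt.
Qed.

Lemma dist_le_sym x y : dist x y <= dist y x.
Proof.
have /walkP[s [ss ps ls]] := dist_walk y x.
apply/dist_min/walkP; exists (rev (belast y s)); split.
- by rewrite size_rev size_belast.
- by rewrite -ls rev_path; under eq_path => a b do rewrite Esym.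
- case: s ps ls {ss} => [|a s] _ /= ls; first by rewrite ls.
  by rewrite rev_cons last_rcons.
Qed.

Lemma dist_sym x y : dist x y = dist y x.
Proof. by apply/eqP; rewrite eqn_leq !dist_le_sym. Qed.

Lemma dist_edge_le x y z : E x y -> dist x z <= (dist y z).+1.
Proof.
move=> xy; rewrite -add1n; apply: leq_trans (dist_triangle x y z) _.
rewrite leq_add2r; apply/dist_min/walkP; exists [:: y].
by rewrite /= xy.
Qed.

Lemma hop_ex x z : x != z -> exists2 e, E x e & dist x z = (dist e z).+1.
Proof.
move=> xz; have /walkP[[|e s] [ss ps ls]] := dist_walk x z.
  by rewrite -ls eqxx in xz.
have /andP[xe pe] := ps; exists e => //.
apply/eqP; rewrite eqn_leq dist_edge_le //= -ss ltnS.
by apply/dist_min/walkP; exists s.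
Qed.

Hypothesis Ecard : #|[set p : T * T | E p.1 p.2]| = 2 * (#|T| - 1).

(* Rooting the tree at r, the pairs (v, parent v) and (parent v, v) are
   2 (#|T| - 1) distinct edges, hence all of them. *)
Definition parent (r v : T) : T :=
  odflt v [pick e | E v e && (dist v r == (dist e r).+1)].

Lemma parentP r v : v != r -> E v (parent r v) /\ dist v r = (dist (parent r v) r).+1.
Proof.
move=> vr; rewrite /parent; case: pickP => [e /andP[ve /eqP de]|no] //=.
have [e ve de] := hop_ex vr.
by have := no e; rewrite ve de eqxx.
Qed.

Lemma parent_root r : parent r r = r.
Proof.
by rewrite /parent; case: pickP => [e /andP[_]|//]; rewrite dist_xx.
Qed.

Lemma edge_parent r x y :
  E x y -> (x != r /\ y = parent r x) \/ (y != r /\ x = parent r y).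
Proof.
move=> xy; pose p := parent r.
pose S1 := [set (v, p v) | v in [set~ r]].
pose S2 := [set (p v, v) | v in [set~ r]].
have c1 : #|S1| = #|T| - 1 by rewrite card_imset ?cardsC1 ?subn1 // => a b [].
have c2 : #|S2| = #|T| - 1 by rewrite card_imset ?cardsC1 ?subn1 // => a b [].
(* Two vertices that are each other's parent would each be farther from [r] than the other. *)
have dis : S1 :&: S2 = set0.
  apply/setP => -[a b]; rewrite !inE; apply/negP => /andP[].
  move=> /imsetP[v]; rewrite !inE => vr [-> ->].
  move=> /imsetP[u]; rewrite !inE => ur [vu uv].
  have [_ dv] := parentP vr; have [_ du] := parentP ur.
  rewrite -/p uv in dv; rewrite -/p -vu in du.
  by move: dv; rewrite du => /eqP; rewrite -addn2 -{1}[dist v r]addn0 eqn_add2l.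
have sub : S1 :|: S2 \subset [set p : T * T | E p.1 p.2].
  apply/subsetP => -[a b]; rewrite !inE => /orP[] /imsetP[v];
    by rewrite !inE => /parentP[ev _] [-> ->]; rewrite //= Esym.
have /eqP eqS : S1 :|: S2 == [set p : T * T | E p.1 p.2].
  by rewrite eqEcard sub Ecard cardsU dis cards0 c1 c2 subn0 mul2n -addnn leqnn.
have : (x, y) \in S1 :|: S2 by rewrite eqS inE.
by rewrite inE => /orP[] /imsetP[v]; rewrite !inE => vr [-> ->]; [left|right].
Qed.

Lemma edge_dist z x y :
  E x y -> dist x z = (dist y z).+1 \/ dist y z = (dist x z).+1.
Proof.
by move=> /(edge_parent z)[] [/parentP[_ +] ->] => ->; [left|right].
Qed.

Lemma dist_edge x y : E x y -> dist x y = 1.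
Proof. by move=> /(edge_dist y)[]; rewrite dist_xx. Qed.

(** A neighbour of [x] nearer to [z] must be the parent of [x] in the tree rooted at [z]. *)
Lemma hop_uniq x z e e' : E x e -> dist x z = (dist e z).+1 ->
  E x e' -> dist x z = (dist e' z).+1 -> e = e'.
Proof.
have hopE a : E x a -> dist x z = (dist a z).+1 -> a = parent z x.
  move=> /(edge_parent z)[[_ //]|[/parentP[_ da] xa]] dx.
  by move: da; rewrite -xa dx; lia.
by move=> xe de xe' de'; rewrite (hopE e) // (hopE e').
Qed.

(* The descendants of v, in the tree rooted at x, can only be left through
   the parent u of v. *)
Lemma hop_separates v u x : E v u -> dist v x = (dist u x).+1 ->
  ~~ connect [rel a b | [&& E a b, a != u & b != u]] v x.
Proof.
move=> vu dv; apply/negP => /connectP[s ps ls].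
pose desc y := exists k, iter k (parent x) y = v.
have uP : u = parent x v.
  have vx : v != x by rewrite -dist_eq0 dv.
  have [vp dp] := parentP vx; exact: (hop_uniq vu dv vp dp).
have : desc x.
  rewrite ls; have : desc v by exists 0.
  elim: s (v) ps {ls} => [|b s IH] a //= /andP[/and3P[ab au bu] ps] [k ak].
  apply: IH ps _; case/(edge_parent x): ab => [[ax bP]|[_ aP]].
    case: k ak => [|k] /= ak; last by exists k; rewrite bP -iterSr.
    by rewrite bP ak -uP eqxx in bu.
  by exists k.+1; rewrite iterSr -aP.
case=> k; rewrite (_ : iter k _ x = x); last first.
  by elim: k => //= k ->; exact: parent_root.
by move=> xv; move: dv; rewrite xv dist_xx.
Qed.

(** Deleting [v] cuts [u] from [y], while deleting a vertex off the edge [uv] leaves [u] and [v]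
    joined. So the path from [u] is [u] followed by the path from [v]. *)
Lemma on_path_hop u v y w : E u v -> dist u y = (dist v y).+1 ->
  [|| w == u, w == y | ~~ connect [rel a b | [&& E a b, a != w & b != w]] u y] =
  (w == u) ||
  [|| w == v, w == y | ~~ connect [rel a b | [&& E a b, a != w & b != w]] v y].
Proof.
move=> uv du; case: eqVneq => //= wu; case: (eqVneq w v) => /= [->|wv].
  by rewrite hop_separates // orbT.
congr (_ || ~~ _).
have vu : E v u by rewrite Esym.
apply/idP/idP => /(connect_trans _) -> //; apply: connect1 => /=.
  by rewrite vu eq_sym wv eq_sym.
by rewrite uv eq_sym wu eq_sym.
Qed.

Lemma on_pathE u y w :
  [|| w == u, w == y | ~~ connect [rel a b | [&& E a b, a != w & b != w]] u y] =
  (dist u w + dist w y == dist u y).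
Proof.
elim: {u}(dist u y) {-2}u (erefl (dist u y)) => [|k IH] u duy.
  move/eqP: duy; rewrite dist_eq0 => /eqP->.
  by rewrite connect0 orbF orbb dist_xx addn_eq0 !dist_eq0 andbC (eq_sym y) andbb.
have uy : u != y by rewrite -dist_eq0 duy.
have [v uv duv] := hop_ex uy.
rewrite (on_path_hop _ uv duv) IH; last by move: duy; rewrite duv => -[].
rewrite duv; case: eqVneq => [->|wu] /=; first by rewrite dist_xx duv eqxx.
have uw : u != w by rewrite eq_sym.
have [v' uv' duv'] := hop_ex uw.
have t1 := dist_triangle v w y; have t2 := dist_triangle v' w y.
have t3 := dist_edge_le w uv; have t4 := dist_edge_le y uv'.
apply/eqP/eqP => [|]; first by lia.
(* The first step [v'] towards [w] also approaches [y], hence it is the first step [v] towards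
   [y]. *)
move=> e; have e' : dist u y = (dist v' y).+1 by lia.
have vv' := hop_uniq uv duv uv' e'; subst v'.
lia.
Qed.

End TreeDistance.

(** * Linking numbers of a splice diagram *)

Lemma splice_connected n (G : splice_diagram n) :
  is_splice_diagram G -> forall u v, connect (sd_E G) u v.
Proof. by case. Qed.

Section SpliceTree.
Variables (n : nat) (G : splice_diagram n) (HG : is_splice_diagram G).
Local Notation V := (sd_V G).
Local Notation E := (sd_E G).
Local Notation lab := (sd_lab G).
Local Notation d := (sd_d G).
Local Notation D := (dist (splice_connected HG)).

(** * Nodes, leaves and branches *)

Lemma adj_sym : ssrbool.symmetric E. Proof. by case: HG. Qed.
Lemma adj_irr : irreflexive E. Proof. by case: HG. Qed.
Lemma adj_card : #|[set p : V * V | E p.1 p.2]| = 2 * (#|V| - 1).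
Proof. by case: HG. Qed.

Let Dsym := dist_sym adj_sym (splice_connected HG).
Let Dxx := dist_xx (splice_connected HG).
Let D0 := dist_eq0 (splice_connected HG).
Let Dtri := dist_triangle (splice_connected HG).
Let Dedge_le := dist_edge_le (splice_connected HG).
Let Dhop := @hop_ex _ _ (splice_connected HG).
Let Dstep := edge_dist adj_sym (splice_connected HG) adj_card.
Let Dadj := dist_edge adj_sym (splice_connected HG) adj_card.
Let Duniq := @hop_uniq _ _ adj_sym (splice_connected HG) adj_card.

Lemma on_path_dist u v w : sd_on_path u v w = (D u w + D w v == D u v).
Proof. exact: (on_pathE adj_sym _ adj_card). Qed.

Lemma val_neq2 (v : V) : sd_val v != 2. Proof. by case: HG => _ _ _ _ []. Qed.
Lemma node_exists : exists v : V, sd_node v. Proof. by case: HG => _ _ _ _ []. Qed.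

Lemma lab_inj : injective lab. Proof. by case: HG => _ _ _ _ []. Qed.

Lemma lab_leaf i : sd_leaf (lab i).
Proof. by case: HG => _ _ _ _ [_ _ _ + _] => ->; exists i. Qed.

Lemma lab_not_node i : sd_node (lab i) = false.
Proof. by rewrite /sd_node (eqP (lab_leaf i)). Qed.

Lemma leaf_lab v : sd_leaf v -> exists i, v = lab i.
Proof. by case: HG => _ _ _ _ [_ _ _ + _] => -> [i <-]; exists i. Qed.

Lemma node_nbr v a b : sd_node v -> exists e, [/\ E v e, e != a & e != b].
Proof.
move=> nv; have : 0 < #|sd_nbrs v :\ a :\ b|.
  have c1 := cardsD1 a (sd_nbrs v); have c2 := cardsD1 b (sd_nbrs v :\ a).
  by move: nv; rewrite /sd_node /sd_val c1 c2; lia.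
by case/card_gt0P => e; rewrite !inE => /and3P[eb ea ve]; exists e.
Qed.

Lemma leaf_nbr i e e' : E (lab i) e -> E (lab i) e' -> e = e'.
Proof.
move=> ee ee'; have /cards1P[a sa] := lab_leaf i.
have: e \in sd_nbrs (lab i) by rewrite inE.
have: e' \in sd_nbrs (lab i) by rewrite inE.
by rewrite sa !inE => /eqP -> /eqP ->.
Qed.

(** A vertex of valency zero would be cut off from the nodes, and valency two is excluded. *)
Lemma vertex_cases v : sd_node v \/ exists i, v = lab i.
Proof.
have [nv|nv] := boolP (sd_node v); [by left|right; apply: leaf_lab].
have [o no] := node_exists.
have ov : v != o by apply: contraNneq nv => ->.
have [e ve _] := Dhop ov.
have : 0 < sd_val v by apply/card_gt0P; exists e; rewrite inE.
by move: nv (val_neq2 v); rewrite /sd_leaf /sd_node; case: (sd_val v) => [|[|[|]]].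
Qed.

Lemma two_nbrs_node v a b : E v a -> E v b -> a != b -> sd_node v.
Proof.
move=> va vb ab; have [//|[i vi]] := vertex_cases v.
by rewrite vi in va vb; rewrite (leaf_nbr va vb) eqxx in ab.
Qed.

(** Two adjacent leaves would each be the other's first step towards a node. *)
Lemma leaf_adj_node i v : E (lab i) v -> sd_node v.
Proof.
move=> iv; have [//|[j vj]] := vertex_cases v; subst v.
have [o no] := node_exists.
have io : lab i != o by apply/eqP => eo; rewrite -eo lab_not_node in no.
have jo : lab j != o by apply/eqP => eo; rewrite -eo lab_not_node in no.
have [e ie de] := Dhop io; have [f jf df] := Dhop jo.
have ji : E (lab j) (lab i) by rewrite adj_sym.
have := leaf_nbr ie iv; have := leaf_nbr jf ji => ? ?; subst e f.
by move: de df; lia.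
Qed.

(** Among the vertices behind [v], one farthest from [x] is a leaf: of two neighbours of a node at
    most one is nearer to [x], so another one is farther. *)
Lemma leaf_behind v x : exists i, D (lab i) x = D (lab i) v + D v x.
Proof.
pose P z := D z x == D z v + D v x.
have Pv : P v by rewrite /P Dxx.
have [z /eqP Pz zmax] := arg_maxnP (fun z => D z x) Pv.
have [nz|[i zi]] := vertex_cases z; last by exists i; rewrite -zi.
have [a [za _ _]] := node_nbr z z nz; have [b [zb ba _]] := node_nbr a a nz.
have [e ze de] : exists2 e, E z e & D e x = (D z x).+1.
  have [da|] := Dstep x za; last by exists a.
  have [db|] := Dstep x zb; last by exists b.
  by rewrite (Duniq za da zb db) eqxx in ba.
have ez : E e z by rewrite adj_sym.
have t1 := Dedge_le v ez; have t2 := Dtri e v x.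
have Pe : P e by apply/eqP; lia.
by have := zmax e Pe; rewrite /= de ltnn.
Qed.

(** For an edge [ve] these are the leaves reached from [v] through [e], the set L(v,e). *)
Definition branch (v e : V) (i : 'I_n) : bool := D v (lab i) == (D e (lab i)).+1.

Lemma branch_nonempty v e : E v e -> exists i, branch v e i.
Proof.
move=> ve; have [i di] := leaf_behind e v; exists i.
by rewrite /branch (Dsym v) di (Dsym e v) (Dadj ve) addn1 (Dsym e).
Qed.

Lemma branch_uniq v e e' i : E v e -> E v e' -> branch v e i -> branch v e' i -> e = e'.
Proof. by move=> ve ve' /eqP b /eqP b'; exact: Duniq ve b ve' b'. Qed.

Lemma branchN v e i : E v e -> branch v e i = ~~ branch e v i.
Proof.
move=> ve; rewrite /branch; case: (Dstep (lab i) ve) => ->; rewrite eqxx.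
  by case: eqP => //; lia.
by case: eqP => //; lia.
Qed.

Lemma branch_leaf v i j : E v (lab i) -> branch v (lab i) j = (j == i).
Proof.
move=> vi; apply/eqP/eqP => [dj|->]; last by rewrite Dxx Dadj.
apply/eqP/negPn/negP => ji.
have ij : lab i != lab j by apply: contra ji => /eqP/lab_inj ->.
have [e ie de] := Dhop ij.
have iv : E (lab i) v by rewrite adj_sym.
have ? := leaf_nbr ie iv; subst e.
by move: dj de; lia.
Qed.

Lemma node_hop v i : sd_node v -> exists2 e, E v e & branch v e i.
Proof.
move=> nv; have vi : v != lab i by apply/eqP => vi; rewrite vi lab_not_node in nv.
by have [e ve de] := Dhop vi; exists e => //; apply/eqP.
Qed.

(** The first step from [w] towards the nearer end of the edge [uv] also leads to the farther
    one. *)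
Lemma common_hop u v w : E u v -> w != u -> w != v ->
  exists e, [/\ E w e, D w u = (D e u).+1 & D w v = (D e v).+1].
Proof.
wlog dwv : u v / D w v = (D w u).+1 => [hyp|] uv wu wv.
  have vu : E v u by rewrite adj_sym.
  have [dw|dw] := Dstep w uv.
    by have [|e [we eu ev]] := hyp v u _ vu wv wu; [rewrite !(Dsym w)|exists e].
  by apply: hyp => //; rewrite !(Dsym w).
have [e we de] := Dhop wu; exists e; split=> //.
have vu : E v u by rewrite adj_sym.
have := Dedge_le e vu; have := Dedge_le v we.
by rewrite (Dsym v e) (Dsym u e); lia.
Qed.

(** * Factorisation of linking numbers along a path *)

Definition ell_at (u y w : V) : nat :=
  \prod_(x in sd_nbrs w | ~~ sd_on_path u y x) d w x.

(** The convention l_{u,u} = d_u is the product formula for a path with one vertex. *)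
Lemma ellE (u y : V) : sd_node u ->
  sd_ell u y = \prod_(w | sd_node w && sd_on_path u y w) ell_at u y w.
Proof.
move=> nu; rewrite /sd_ell; case: eqVneq => // <-.
have onu x : sd_on_path u u x = (x == u).
  by rewrite on_path_dist Dxx addn_eq0 !D0 (eq_sym u) andbb.
rewrite (big_pred1 u) => [|w]; last first.
  by rewrite onu /=; case: eqVneq => [->|_]; rewrite ?nu ?andbF.
apply: eq_bigl => x; rewrite onu inE; case: eqVneq => [->|_].
  by rewrite adj_irr.
by rewrite andbT.
Qed.

Lemma on_path_step u v y w : E u v -> D u y = (D v y).+1 ->
  sd_on_path u y w = (w == u) || sd_on_path v y w.
Proof. exact: (on_path_hop adj_sym adj_card). Qed.

Lemma on_path_prev u v y : E u v -> D u y = (D v y).+1 -> sd_on_path v y u = false.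
Proof. by move=> uv duy; rewrite on_path_dist duy; apply/eqP; lia. Qed.

Lemma ell_at_start u v y : E u v -> D u y = (D v y).+1 ->
  ell_at u y u = \prod_(x in sd_nbrs u | x != v) d u x.
Proof.
move=> uv duy; apply: eq_bigl => x; rewrite inE.
case ux: (E u x) => //=; congr (~~ _); rewrite (on_path_step _ uv duy).
case: (eqVneq x u) => [xu|_ /=]; first by rewrite xu adj_irr in ux.
rewrite on_path_dist -(D0 x v) (Dsym v); have := Dtri x v y.
by case: (Dstep y ux) => ? ?; apply/eqP/eqP; lia.
Qed.

Lemma ell_at_next u v y : E u v -> D u y = (D v y).+1 ->
  d v u * ell_at u y v = ell_at v y v.
Proof.
move=> uv duy; have vu : E v u by rewrite adj_sym.
rewrite [RHS](bigD1 u) /=; last by rewrite inE vu (on_path_prev uv duy).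
congr (_ * _); apply: eq_bigl => x.
by rewrite (on_path_step _ uv duy) negb_or andbA andbAC.
Qed.

Lemma ell_at_further u v y w : E u v -> D u y = (D v y).+1 ->
  sd_on_path v y w -> w != v -> ell_at u y w = ell_at v y w.
Proof.
move=> uv duy; rewrite on_path_dist => /eqP vwy wv.
apply: eq_bigl => x; rewrite (on_path_step _ uv duy) inE.
case: eqVneq => [->|//] /=; rewrite (on_path_prev uv duy) andbF andbT.
apply/esym/negP => wu; move: wv; rewrite -D0 Dsym.
by case: (Dstep y wu); lia.
Qed.

Lemma dv_nbr u v : E u v -> sd_dv u = d u v * \prod_(x in sd_nbrs u | x != v) d u x.
Proof. by move=> uv; rewrite /sd_dv (bigD1 v) //= inE. Qed.

Lemma ell_factor u v y : sd_node u -> E u v -> D u y = (D v y).+1 ->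
  sd_ell u y = \prod_(x in sd_nbrs u | x != v) d u x *
    \prod_(w | sd_node w && sd_on_path v y w) ell_at u y w.
Proof.
move=> nu uv duy; rewrite ellE // (bigD1 u) /=; last first.
  by rewrite nu (on_path_step _ uv duy) eqxx.
rewrite (ell_at_start uv duy); congr (_ * _); apply: eq_bigl => w.
rewrite (on_path_step _ uv duy); case: eqVneq => [->|_] /=.
  by rewrite (on_path_prev uv duy) !andbF.
by rewrite andbT.
Qed.

(** Prepending [u] to the path from [v] contributes d_u / d_{u,v} at [u] and removes d_{v,u} at [v].
    Hence w_v / w_u is constant on the leaves on the side of [v]. *)
Lemma ell_hop u v y : sd_node u -> sd_node v -> E u v -> D u y = (D v y).+1 ->
  sd_ell u y * (d u v * d v u) = sd_dv u * sd_ell v y.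
Proof.
move=> nu nv uv duy; rewrite (ell_factor nu uv duy) (ellE _ nv) (dv_nbr uv).
have Pv : sd_node v && sd_on_path v y v by rewrite nv on_path_dist Dxx eqxx.
rewrite !(bigD1 v Pv) /= -(ell_at_next uv duy).
under [X in _ * (_ * X) * _]eq_bigr => w /andP[/andP[_ ow] wv].
  by rewrite (ell_at_further uv duy ow wv); over.
lia.
Qed.

Lemma nbr_gt0 (v x : V) : sd_node v -> E v x -> 0 < d v x.
Proof. by case: HG => _ _ _ _ [_ _ _ _]; apply. Qed.

Lemma ell_gt0 (u y : V) : sd_node u -> 0 < sd_ell u y.
Proof.
move=> nu; rewrite (ellE _ nu); apply: prodn_cond_gt0 => w /andP[nw _].
by apply: prodn_cond_gt0 => x /andP[]; rewrite inE => wx _; exact: nbr_gt0.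
Qed.

(** * Monotonicity of the ratios of the vectors [wvec] *)

Hypothesis Hdet : sd_edge_det G.

(** By [ell_hop] at [y = v], d_u d_v = l_{u,v} d_{u,v} d_{v,u}. In this form the condition compares
    the two values of the ratio across an edge. *)
Lemma edge_det_sq (u v : V) : sd_node u -> sd_node v -> E u v ->
  sd_dv u * sd_dv v < (d u v * d v u) ^ 2.
Proof.
move=> nu nv uv; have det := Hdet nu nv uv.
have := @ell_hop u v v nu nv uv; rewrite Dxx Dadj // {2}/sd_ell eqxx => /(_ erefl) <-.
by rewrite expnS expn1 ltn_pmul2r //; apply: leq_ltn_trans det.
Qed.

Definition wvec (u : V) (i : 'I_n) : nat :=
  if sd_node u then sd_ell u (lab i) else lab i == u.

Lemma wvec_gt0 u i : sd_node u -> 0 < wvec u i.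
Proof. by move=> nu; rewrite /wvec nu ell_gt0. Qed.

Lemma wvec_lab i j : wvec (lab i) j = (j == i).
Proof. by rewrite /wvec lab_not_node (inj_eq lab_inj). Qed.

(** With p = d_{x,e} d_{e,x}, the ratio [wvec e / wvec x] between nodes is d_e / p on the side of
    [x] and p / d_x on the side of [e]; [edge_det_sq] makes the first smaller. Products replace
    quotients because leaf vectors have zeros. *)
Lemma wvec_edge_le x e i j : E x e -> branch e x i ->
  wvec x j * wvec e i <= wvec e j * wvec x i ?= iff (branch e x j).
Proof.
move=> xe bi; have ex : E e x by rewrite adj_sym.
have [nx|[k xk]] := vertex_cases x; last first.
  have ne : sd_node e by apply: (@leaf_adj_node k); rewrite -xk.
  rewrite {}xk in xe ex bi *; move: bi; rewrite !branch_leaf // => /eqP->.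
  rewrite !wvec_lab eqxx muln1; apply/leqifP.
  by case: (eqVneq j k) => [->|_]; rewrite ?mul1n ?mul0n ?wvec_gt0.
have [ne|[k ek]] := vertex_cases e; last first.
  rewrite {}ek in xe ex bi *; move: bi; rewrite !(branchN _ ex) !branch_leaf // => ik.
  rewrite !wvec_lab (negbTE ik) muln0; apply/leqifP.
  by case: (eqVneq j k) => _ //=; rewrite mul1n wvec_gt0.
have hi := ell_hop ne nx ex (eqP bi).
rewrite /wvec nx ne; have det := edge_det_sq nx ne xe.
have pe := ell_gt0 (lab i) ne; have px := ell_gt0 (lab i) nx.
have pd : 0 < d e x * d x e by rewrite muln_gt0 !nbr_gt0.
apply/leqifP; case: (boolP (branch e x j)) => [bj|].
  have hj := ell_hop ne nx ex (eqP bj).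
  rewrite -(eqn_pmul2r pd); apply/eqP.
  by rewrite -[LHS]mulnA hi mulnAC hj; lia.
rewrite -(branchN _ xe) => bj.
have hj := ell_hop nx ne xe (eqP bj).
have pj := ell_gt0 (lab j) ne.
move: pd det hi hj; rewrite [d x e * _]mulnC; set p := d e x * d x e.
set xi := sd_ell x (lab i) in px *; set xj := sd_ell x (lab j).
set ei := sd_ell e (lab i) in pe *; set ej := sd_ell e (lab j) in pj *.
move=> pd det hi hj; have pp : 0 < p * p by rewrite muln_gt0 pd.
rewrite -(ltn_pmul2r pp) mulnACA hj hi mulnACA [ej * xi * _]mulnC mulnn.
by rewrite ltn_pmul2r // muln_gt0 pj.
Qed.

Lemma hop_behind x e z i : E x e -> D x z = (D e z).+1 ->
  D z (lab i) = D z x + D x (lab i) ->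
  branch e x i /\ D z (lab i) = D z e + D e (lab i).
Proof.
move=> xe dxz dzi; have ex : E e x by rewrite adj_sym.
have := Dtri z e (lab i); have := Dedge_le (lab i) ex.
by rewrite /branch; move: dxz dzi; rewrite (Dsym x z) (Dsym e z); split; [apply/eqP|]; lia.
Qed.

Lemma hop_node x e z : E x e -> D x z = (D e z).+1 -> e != z -> sd_node e.
Proof.
move=> xe dxz ez; have [f ef def] := Dhop ez.
apply: (@two_nbrs_node e x f) => //; first by rewrite adj_sym.
by apply/eqP => xf; move: dxz; rewrite def xf; lia.
Qed.

(** Multiply [wvec_edge_le] along the path from [x] to [z]; the intermediate vertices are nodes, so
    their positive coordinates cancel. *)
Lemma wvec_le x z i j : D z (lab i) = D z x + D x (lab i) ->
  wvec x j * wvec z i <= wvec z j * wvec x i.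
Proof.
elim: {x}(D x z) {-2}x (erefl (D x z)) => [|k IH] x dxz dzi.
  by move/eqP: dxz; rewrite D0 => /eqP->.
have [e xe dx] : exists2 e, E x e & D x z = (D e z).+1 by apply: Dhop; rewrite -D0 dxz.
have [bi dzi'] := hop_behind xe dx dzi.
have [ez|ez] := eqVneq e z; first by rewrite -ez; case: (wvec_edge_le j xe bi).
have dez : D e z = k by move: dxz; rewrite dx => -[].
have le1 := IH e dez dzi'.
have [le2 _] := wvec_edge_le j xe bi.
have pe := wvec_gt0 i (hop_node xe dx ez).
rewrite -(leq_pmul2r pe) mulnAC; apply: leq_trans (leq_mul le2 (leqnn _)) _.
by rewrite mulnAC [_ * _ * wvec e i]mulnAC leq_mul2r le1 orbT.
Qed.

(** The first edge is already strict, as [j] is on its far side. For a leaf [z] other than that of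
    [j] the right side would vanish, whence the last hypothesis. *)
Lemma wvec_lt x e z i j : E x e -> D x z = (D e z).+1 ->
  D z (lab i) = D z x + D x (lab i) -> branch x e j ->
  sd_node z || (z == lab j) ->
  wvec x j * wvec z i < wvec z j * wvec x i.
Proof.
move=> xe dx dzi bj zj; have [bi dzi'] := hop_behind xe dx dzi.
have := wvec_edge_le j xe bi; rewrite branchN ?(adj_sym e) // bj => /leqifP lt1.
have [<- //|ez] := eqVneq e z.
have ne := hop_node xe dx ez.
have pe := wvec_gt0 i ne; have le1 := wvec_le j dzi'.
have xi : 0 < wvec x i.
  by move: lt1; case: (wvec x i) => //; rewrite muln0.
case/orP: zj => [nz|/eqP zj].
  have pz := wvec_gt0 i nz.
  rewrite -(ltn_pmul2r pe) mulnAC.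
  apply: (@leq_trans (wvec e j * wvec x i * wvec z i)); first by rewrite ltn_pmul2r.
  by rewrite mulnAC [_ * _ * wvec e i]mulnAC leq_mul2r le1 orbT.
rewrite zj !wvec_lab eqxx mul1n; case: eqVneq => [ij|]; last by rewrite muln0.
by move: dzi; rewrite zj ij Dxx => /esym/eqP; rewrite addn_eq0 D0 => /andP[/eqP jx _];
  move: dx; rewrite zj jx Dxx.
Qed.

(* The leaves at which the ratio wvec u / wvec v is not minimal. *)
Definition big_ratio (v u : V) : pred 'I_n :=
  fun i => [exists j, wvec u j * wvec v i < wvec u i * wvec v j].

(** Since [y] and [u] lie on opposite sides of [ve], each step towards [u] moves away from [y]: the
    only neighbour nearer to [y] is the one just left. *)
Lemma dist_concat v e u y : E v e -> D e y = (D v y).+1 -> D v u = (D e u).+1 ->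
  D u y = D u v + D v y.
Proof.
elim: {e}(D e u) {-2}e v (erefl (D e u)) => [|k IH] e v deu ve dey dvu.
  by move/eqP: (deu); rewrite D0 => /eqP eu; rewrite -eu (Dsym e v) (Dadj ve) dey add1n.
have [f ef def] : exists2 f, E e f & D e u = (D f u).+1 by apply: Dhop; rewrite -D0 deu.
have dfy : D f y = (D e y).+1.
  have [dey'|//] := Dstep y ef.
  have ev : E e v by rewrite adj_sym.
  have vf := Duniq ev dey ef dey'.
  by move: dvu; rewrite def vf; lia.
have dfu : D f u = k by move: deu; rewrite def => -[].
by rewrite (IH f e dfu ef dfy def) (Dsym u v) (Dsym u e) dvu dey; lia.
Qed.

Lemma other_branch v e : sd_node v -> E v e -> exists j, ~~ branch v e j.
Proof.
move=> nv ve; have [f [vf fe _]] := node_nbr e e nv.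
have [j bj] := branch_nonempty vf; exists j.
by apply: contra fe => bj'; rewrite (branch_uniq vf ve bj bj').
Qed.

(** Leaves outside the branch are behind [v] as seen from [u], so the ratio is minimal there by
    [wvec_le]; inside it is strictly larger by [wvec_lt]. A leaf [u] not adjacent to [v] is
    excluded, since its vector has a single nonzero coordinate. *)
Lemma big_ratioE v u e : sd_node v -> E v e -> D v u = (D e u).+1 ->
  sd_node u \/ u = e -> big_ratio v u =1 branch v e.
Proof.
move=> nv ve dvu ue i.
have far j : ~~ branch v e j -> D u (lab j) = D u v + D v (lab j).
  rewrite (branchN _ ve) negbK /branch => /eqP dej; exact: dist_concat ve dej dvu.
apply/existsP/idP => [[j]|bi].
  by apply: contraLR => /far di; rewrite -leqNgt mulnC wvec_le.
have [j bj] := other_branch nv ve; exists j.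
rewrite mulnC; apply: (wvec_lt ve dvu (far j bj) bi).
case: ue => [->//|ue]; have [->//|[k uk]] := vertex_cases u.
by move: bi ve; rewrite -ue uk => + ve; rewrite branch_leaf // => /eqP ->; rewrite eqxx orbT.
Qed.

Lemma big_ratio_adj v e : sd_node v -> E v e -> big_ratio v e =1 branch v e.
Proof.
by move=> nv ve; apply: big_ratioE => //; [rewrite Dxx Dadj | right].
Qed.

(** * Recovering the weights *)

Hypothesis Hco : sd_coprime G.

Lemma nbr_coprime v x y : sd_node v -> E v x -> E v y -> x != y -> coprime (d v x) (d v y).
Proof. exact: Hco. Qed.

Lemma beyond_trans x e f z : E x e -> E e f -> f != x -> D e z = (D f z).+1 ->
  D x z = (D e z).+1.
Proof.
move=> xe ef fx dez; have [//|dex] := Dstep z xe.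
have ex : E e x by rewrite adj_sym.
by rewrite (Duniq ef dez ex dex) eqxx in fx.
Qed.

(* Among the edges at e other than ex, at most one has a weight divisible
   by r: a leaf is reached by following that edge whenever there is one. *)
Lemma coprime_continuation r x e : prime r -> sd_node e -> E e x ->
  exists f, [/\ E e f, f != x &
    forall y, E e y -> y != x -> y != f -> ~~ (r %| d e y)].
Proof.
move=> rp ne ex.
case: (pickP (fun f => [&& E e f, f != x & r %| d e f])) => [f /and3P[ef fx rf]|no].
  exists f; split=> // y ey yx yf; apply/negP => ry.
  have fy : f != y by rewrite eq_sym.
  have : r %| gcdn (d e f) (d e y) by rewrite dvdn_gcd rf ry.
  by rewrite (eqP (nbr_coprime ne ef ey fy)) (Euclid_dvd1 rp).
have [f [ef fx _]] := node_nbr x x ne; exists f; split=> // y ey yx _.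
by have := no y; rewrite ey yx /= => ->.
Qed.

Lemma prime_ndvd_prod (I : finType) (P : pred I) (F : I -> nat) r : prime r ->
  (forall i, P i -> ~~ (r %| F i)) -> ~~ (r %| \prod_(i | P i) F i).
Proof.
move=> rp; apply: (big_ind (fun m => ~~ (r %| m))); first by rewrite Euclid_dvd1.
by move=> a b ra rb; rewrite Euclid_dvdM // negb_or ra.
Qed.

(** Follow at each node the edge from [coprime_continuation], the only onward one whose weight [r]
    may divide; lying on the path, it does not enter the product. The induction is on the number of
    vertices beyond [e]. *)
Lemma prime_ndvd_beyond r x e : prime r -> E x e ->
  exists2 i, branch x e i &
    ~~ (r %| \prod_(w | sd_node w && sd_on_path e (lab i) w) ell_at x (lab i) w).
Proof.
move=> rp; pose B x e := [set z | D x z == (D e z).+1].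
elim: {x e}#|B x e|.+1 {-2}x {-2}e (ltnSn #|B x e|) => // k IH x e ltB xe.
have ex : E e x by rewrite adj_sym.
have [ne|[i ei]] := vertex_cases e; last first.
  exists i; first by rewrite ei branch_leaf ?eqxx -?ei.
  rewrite big_pred0 ?Euclid_dvd1 // => w.
  rewrite on_path_dist -ei Dxx addn_eq0 !D0.
  by case: eqVneq => [<-|_]; rewrite ?andbF // ei lab_not_node.
have [f [ef fx rf]] := coprime_continuation rp ne ex.
have ltB' : #|B e f| < k.
  rewrite -ltnS; apply: leq_trans ltB; rewrite ltnS; apply/proper_card/properP; split.
    by apply/subsetP => z; rewrite !inE => /eqP/(beyond_trans xe ef fx)/eqP.
  by exists e; rewrite !inE Dxx ?(Dadj xe) //; apply/eqP; lia.
have [i bi ri] := IH e f ltB' ef.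
have dxi := beyond_trans xe ef fx (eqP bi).
exists i; first exact/eqP.
have Pe : sd_node e && sd_on_path e (lab i) e by rewrite ne on_path_dist Dxx eqxx.
rewrite (bigD1 e Pe) /= Euclid_dvdM // negb_or; apply/andP; split.
  apply: prime_ndvd_prod => // y; rewrite inE (on_path_step _ xe dxi) => /andP[ey].
  rewrite negb_or => /andP[yx]; rewrite (on_path_step _ ef (eqP bi)) negb_or => /andP[_ yf].
  apply: rf => //; apply: contraNneq yf => ->.
  by rewrite on_path_dist Dxx.
rewrite (eq_bigr (ell_at e (lab i))) => [|w /andP[/andP[_ ew] we]]; last first.
  exact: (ell_at_further xe dxi ew we).
rewrite (eq_bigl (fun w => sd_node w && sd_on_path f (lab i) w)) // => w.
rewrite (on_path_step _ ef (eqP bi)); case: eqVneq => [->|_]; last by rewrite andbT.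
by rewrite (on_path_prev ef (eqP bi)) !andbF.
Qed.

Lemma wvec_dvd v u i : sd_node v -> E v u -> ~~ branch v u i -> d v u %| wvec v i.
Proof.
move=> nv vu bi; have vi : v != lab i by apply/eqP => vi; rewrite vi lab_not_node in nv.
have [e ve de] := Dhop vi.
rewrite /wvec nv (ell_factor nv ve de) (bigD1 u) /= -?mulnA ?dvdn_mulr // inE vu.
by apply: contra bi => /eqP ->; apply/eqP.
Qed.

(** Leave [v] by the edge other than [vu] whose weight [r] may divide, and continue as in
    [prime_ndvd_beyond]; the cofactor of [d v u] in [wvec v i] is then prime to [r]. *)
Lemma prime_ndvd_wvec r v u : prime r -> sd_node v -> E v u ->
  exists2 i, ~~ branch v u i & ~~ (r * d v u %| wvec v i).
Proof.
move=> rp nv vu; have [e [ve eu re]] := coprime_continuation rp nv vu.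
have [i bi ri] := prime_ndvd_beyond rp ve; exists i.
  by apply: contra eu => bi'; rewrite (branch_uniq ve vu bi bi').
rewrite /wvec nv (ell_factor nv ve (eqP bi)) (bigD1 u) /=; last by rewrite inE vu eq_sym.
rewrite -mulnA mulnC dvdn_pmul2l ?nbr_gt0 // Euclid_dvdM // negb_or ri andbT.
by apply: prime_ndvd_prod => // y /andP[/andP[]]; rewrite inE => vy ye yu; apply: re.
Qed.

(** [d v u] divides the gcd by [wvec_dvd], and a prime factor of the quotient would contradict
    [prime_ndvd_wvec]. *)
Lemma weight_gcd v u : sd_node v -> E v u ->
  \big[gcdn/0]_(i | ~~ branch v u i) wvec v i = d v u.
Proof.
move=> nv vu; set g := (X in X = _).
have gdvd i : ~~ branch v u i -> g %| wvec v i by move=> bi; apply: (biggcdn_inf i).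
have /dvdnP[h gE] : d v u %| g by apply/dvdn_biggcdP => i; exact: wvec_dvd.
rewrite gE; suff -> : h = 1 by rewrite mul1n.
apply/eqP/negPn/negP => h1.
have [i bi] := other_branch nv vu.
have g0 : 0 < g by apply: dvdn_gt0 (gdvd _ bi); exact: wvec_gt0.
have h2 : 1 < h by move: g0; rewrite gE muln_gt0 => /andP[h0 _]; rewrite ltn_neqAle eq_sym h1.
have [j bj /negP[]] := prime_ndvd_wvec (pdiv_prime h2) nv vu.
by apply: dvdn_trans (gdvd _ bj); rewrite gE dvdn_mul // pdiv_dvd.
Qed.

(** By [weight_gcd] the gcd of all coordinates divides two different weights at [v], which are
    coprime. *)
Lemma wvec_primitive v : sd_node v -> \big[gcdn/0]_i wvec v i = 1.
Proof.
move=> nv; apply/eqP; rewrite -dvdn1.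
have [a [va _ _]] := node_nbr v v nv; have [b [vb ba _]] := node_nbr a a nv.
rewrite -(eqP (nbr_coprime nv vb va ba)) dvdn_gcd.
by rewrite -!weight_gcd //; apply/andP; split; apply/dvdn_biggcdP => i _; exact: biggcdn_inf.
Qed.

Lemma other_label i : exists j : 'I_n, j != i.
Proof.
have [v nv] := node_exists.
have vi : v != lab i by apply/eqP => vi; rewrite vi lab_not_node in nv.
have [e ve de] := Dhop vi; have [j bj] := other_branch nv ve; exists j.
by apply: contra bj => /eqP ->; apply/eqP.
Qed.

(** A leaf vector has a zero because there are at least two leaves. Nodes can thus be recognised
    from their vectors. *)
Lemma node_wvec v : sd_node v = [forall i, 0 < wvec v i].
Proof.
have [nv|[i vi]] := vertex_cases v.
  by rewrite nv; apply/esym/forallP => i; exact: wvec_gt0.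
have [j ji] := other_label i; rewrite vi lab_not_node; apply/esym/forallP => /(_ j).
by rewrite wvec_lab (negbTE ji).
Qed.

(** For distinct nodes [big_ratioE] gives a leaf with non-minimal ratio, so the ratio is not
    constant. *)
Lemma wvec_inj u v : wvec u =1 wvec v -> u = v.
Proof.
move=> uv; have nuv : sd_node u = sd_node v.
  by rewrite !node_wvec; apply: eq_forallb => i; rewrite uv.
have [nu|[i ui]] := vertex_cases u; last first.
  have [nv|[j vj]] := vertex_cases v; first by rewrite -nuv ui lab_not_node in nv.
  by have := uv i; rewrite ui vj !wvec_lab eqxx; case: eqVneq => // ->.
apply/eqP/negPn/negP; rewrite eq_sym => vu; rewrite nuv in nu.
have [e ve de] := Dhop vu; have [i bi] := branch_nonempty ve.
have : big_ratio v u i by rewrite (big_ratioE nu ve de) ?nuv //; left.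
by case/existsP => j; rewrite !uv mulnC ltnn.
Qed.

(** * Points of the splice fan *)

Section Fan.
Variable R : realType.
Local Notation W u i := ((wvec u i)%:R : R)%R.
Local Open Scope ring_scope.

Lemma sd_wE (u : V) i : sd_w R u i = W u i.
Proof. by rewrite /sd_w /wvec; case: ifP. Qed.

Lemma wvec_support u : exists i, (0 < wvec u i)%N.
Proof.
have [nu|[i ->]] := vertex_cases u; last by exists i; rewrite wvec_lab eqxx.
have [e [ue _ _]] := node_nbr u u nu; have [i _] := branch_nonempty ue.
by exists i; exact: wvec_gt0.
Qed.

Lemma total_gt0 (u : V) : 0 < \sum_(j < n) sd_w R u j.
Proof.
have [i ui] := wvec_support u; rewrite (bigD1 i) //= ltr_wpDr //.
  by apply: sumr_ge0 => j _; rewrite sd_wE ler0n.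
by rewrite sd_wE ltr0n.
Qed.

Lemma fan_cone (x : 'I_n -> R) : in_splice_fan G x ->
  exists u v a b, [/\ E u v, 0 <= a, 0 <= b & forall i, x i = a * W u i + b * W v i].
Proof.
case=> u [v [uv [t [s [t0 s0 s1 xE]]]]].
exists u, v, (t * (1 - s) / \sum_(j < n) sd_w R u j), (t * s / \sum_(j < n) sd_w R v j).
split=> //.
- by rewrite divr_ge0 ?mulr_ge0 ?subr_ge0 // ltW // total_gt0.
- by rewrite divr_ge0 ?mulr_ge0 // ltW // total_gt0.
- move=> i; rewrite xE /sd_rho !sd_wE; ring.
Qed.

Lemma cone_fan (u v : V) (a b : R) : E u v -> 0 <= a -> 0 <= b ->
  in_splice_fan G (fun i => a * W u i + b * W v i).
Proof.
move=> uv a0 b0; exists u, v; split=> //.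
have := total_gt0 u; have := total_gt0 v.
set Sv := \sum_(j < n) sd_w R v j; set Su := \sum_(j < n) sd_w R u j => Sv0 Su0.
(* The scalar is the 1-norm of the point and the affine parameter is the share of [v] in it; if the
   norm is zero, so are [a] and [b]. *)
have [t0|t0] := eqVneq (a * Su + b * Sv) 0.
  have aS : 0 <= a * Su by rewrite mulr_ge0 // ltW.
  have bS : 0 <= b * Sv by rewrite mulr_ge0 // ltW.
  have /eqP : a * Su = 0 by lra.
  have /eqP : b * Sv = 0 by lra.
  rewrite !mulf_eq0 (gt_eqF Su0) (gt_eqF Sv0) !orbF => /eqP -> /eqP ->.
  exists 0, 0; split=> // i; ring.
have tS : 0 < a * Su + b * Sv by rewrite lt_neqAle eq_sym t0 addr_ge0 ?mulr_ge0 // ltW.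
exists (a * Su + b * Sv), (b * Sv / (a * Su + b * Sv)); split.
- exact: ltW.
- by rewrite divr_ge0 ?mulr_ge0 // ltW.
- by rewrite ler_pdivrMr // mul1r lerDr mulr_ge0 // ltW.
- move=> i; rewrite /sd_rho -/Su -/Sv !sd_wE; field.
  by rewrite t0 (gt_eqF Su0) (gt_eqF Sv0).
Qed.

(** As seen from [z], the leaf [i] is behind both [x] and [y], so [wvec_le] applies to each; when
    [z] is a node the contribution of [x] is strict by [wvec_lt]. *)
Lemma cross_beyond x y z i j (a b : R) : E x y -> branch y x i -> branch x y j ->
  D x z = (D y z).+1 -> 0 < a -> 0 <= b ->
  let p k := a * W x k + b * W y k in
  p j * W z i <= W z j * p i /\ (sd_node z -> p j * W z i < W z j * p i).
Proof.
move=> xy bi bj dxz a0 b0 p.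
have zyi : D z (lab i) = (D z y + D y (lab i))%N.
  by rewrite (dist_concat xy (eqP bi) dxz) (eqP bi) (Dsym z x) dxz (Dsym z y) addnS.
have zxi := dist_concat xy (eqP bi) dxz.
have ley : W y j * W z i <= W z j * W y i by rewrite -!natrM ler_nat wvec_le.
have lex : W x j * W z i <= W z j * W x i by rewrite -!natrM ler_nat wvec_le.
have by' := ler_wpM2l b0 ley.
split=> [|nz].
  have bx := ler_wpM2l (ltW a0) lex; rewrite /p; lra.
have ltx : W x j * W z i < W z j * W x i.
  by rewrite -!natrM ltr_nat; apply: (wvec_lt xy dxz zxi bj); rewrite nz.
rewrite -(ltr_pM2l a0) in ltx; rewrite /p; lra.
Qed.

(** The path from [x'] to [y'] has length one and contains the edge [xy]. *)
Lemma edge_cases (x y x' y' : V) : E x y -> E x' y' ->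
  D x x' = (D y x').+1 -> D y y' = (D x y').+1 -> x' = y /\ y' = x.
Proof.
move=> xy xy' dx dy; have := dist_concat xy dy dx; rewrite (Dadj xy') (Dsym x' x) dx addSn => -[].
by move=> /esym/eqP; rewrite addn_eq0 (Dsym y) !D0 => /andP[/eqP -> /eqP ->].
Qed.

(** A leaf vector has a zero coordinate, so a positive point needs a positive multiple of a node
    vector. *)
Lemma cone_node_coeff x y (a b : R) : E x y -> 0 <= a -> 0 <= b ->
  (forall k, 0 < a * W x k + b * W y k) ->
  (sd_node x /\ 0 < a) \/ (sd_node y /\ 0 < b).
Proof.
move=> xy a0 b0 pos; have [k _] := wvec_support x.
have leaf0 z : ~~ sd_node z -> exists j, wvec z j = 0%N.
  have [->//|[i ->] _] := vertex_cases z.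
  by have [j ji] := other_label i; exists j; rewrite wvec_lab (negbTE ji).
have [nx|nx] := boolP (sd_node x).
  have [a1|a1] := eqVneq a 0; last by left; rewrite lt_neqAle eq_sym a1.
  right; have [ny|/leaf0[j yj]] := boolP (sd_node y).
    split=> //; rewrite lt_neqAle b0 andbT; apply/eqP => b1.
    by have := pos k; rewrite a1 -b1; lra.
  by have := pos j; rewrite a1 yj; lra.
right; have [j xj] := leaf0 _ nx.
have [i xi] : exists i, x = lab i by case: (vertex_cases x) nx => // ->.
split; first by apply: (@leaf_adj_node i); rewrite -xi.
rewrite lt_neqAle b0 andbT; apply/eqP => b1.
by have := pos j; rewrite -b1 xj; lra.
Qed.

Lemma cone_beyond x y x' y' i j (a b a' b' : R) : E x y -> branch y x i -> branch x y j ->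
  D x x' = (D y x').+1 -> D x y' = (D y y').+1 -> E x' y' ->
  0 < a -> 0 <= b -> 0 <= a' -> 0 <= b' ->
  let p k := a * W x k + b * W y k in
  let q k := a' * W x' k + b' * W y' k in
  (forall k, 0 < q k) -> p j * q i < q j * p i.
Proof.
move=> xy bi bj dx dy xy' a0 b0 a0' b0' p q qpos.
have [le1 lt1] := cross_beyond xy bi bj dx a0 b0.
have [le2 lt2] := cross_beyond xy bi bj dy a0 b0.
have lea := ler_wpM2l a0' le1; have leb := ler_wpM2l b0' le2.
have := cone_node_coeff xy' a0' b0' qpos.
rewrite /p /q.
case=> [[nx a1]|[ny b1]].
  have := lt1 nx; rewrite -(ltr_pM2l a1) => ?; lra.
have := lt2 ny; rewrite -(ltr_pM2l b1) => ?; lra.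
Qed.

(** If [x'y'] lies on one side of [xy], then [cone_beyond] forbids equal ratios at [i] and [j].
    Otherwise the two edges coincide and both points lie in one planar cone. *)
Lemma cone_cross x y x' y' i j (a b a' b' : R) :
  E x y -> branch y x i -> branch x y j -> E x' y' ->
  0 < a -> 0 < b -> 0 <= a' -> 0 <= b' ->
  let p k := a * W x k + b * W y k in
  let q k := a' * W x' k + b' * W y' k in
  (forall k, 0 < q k) -> p j * q i = q j * p i ->
  forall k l, q k * p l = q l * p k.
Proof.
move=> xy bi bj xy' a0 b0 a0' b0' p q qpos pq.
have yx : E y x by rewrite adj_sym.
have same (c d' : R) : (forall k, q k = c * W x k + d' * W y k) ->
    forall k l, q k * p l = q l * p k.
  move=> qE; have lt : W x j * W y i < W y j * W x i.
    rewrite -!natrM ltr_nat; move: (wvec_edge_le j xy bi) => /leqifP.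
    by rewrite (branchN _ yx) bj.
  (* The first factor is the determinant of the coefficients of [p] and [q], the second a nonzero
     minor of the vectors of [x] and [y]. *)
  have det0 : (a * d' - b * c) * (W x j * W y i - W y j * W x i) = 0.
    by move: pq; rewrite /p !qE => /eqP; rewrite -subr_eq0 => /eqP <-; ring.
  move/eqP: det0; rewrite mulf_eq0 subr_eq0 [X in _ || X]subr_eq0 (lt_eqF lt) orbF.
  move=> /eqP ab k l; rewrite !qE /p.
  have : (b * c - a * d') * (W x k * W y l - W y k * W x l) = 0.
    by rewrite ab subrr mul0r.
  by move=> /eqP; rewrite -subr_eq0 => /eqP h; apply/eqP; rewrite -subr_eq0 -h; apply/eqP; ring.
case: (Dstep x' xy) => dx; case: (Dstep y' xy) => dy.
- by have := cone_beyond xy bi bj dx dy xy' a0 (ltW b0) a0' b0' qpos; rewrite -/(p _) pq ltxx.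
- have [ex ey] := edge_cases xy xy' dx dy; apply: (same b' a') => k.
  by rewrite /q ex ey addrC.
- have [ex ey] := edge_cases yx xy' dx dy; apply: (same a' b') => k.
  by rewrite /q ex ey.
- have := cone_beyond yx bj bi dx dy xy' b0 (ltW a0) a0' b0' qpos.
  by move: pq; rewrite /p /q => ? ?; lra.
Qed.

End Fan.

End SpliceTree.

(** f k = gcd_l (f k g l) = gcd_l (f l g k) = g k. *)
Lemma primitive_ray n (f g : 'I_n -> nat) :
  \big[gcdn/0]_i f i = 1 -> \big[gcdn/0]_i g i = 1 ->
  (forall k l, f k * g l = f l * g k) -> f =1 g.
Proof.
move=> f1 g1 fg k.
rewrite -[LHS]muln1 -[RHS]muln1 -{1}g1 -f1.
rewrite !(big_morph (muln _) (muln_gcdr _) (muln0 _)).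
by apply: eq_bigr => l _; rewrite fg mulnC.
Qed.

(** * Comparison of two splice diagrams *)

Section Comparison.
Variables (R : realType) (n : nat) (G G' : splice_diagram n).
Hypotheses (HG : is_splice_diagram G) (Hdet : sd_edge_det G) (Hco : sd_coprime G).
Hypotheses (HG' : is_splice_diagram G') (Hdet' : sd_edge_det G') (Hco' : sd_coprime G').

(* If the ray of v lay inside the cone over an edge xy of G', then every
   positive q in the fan off that ray would have a non-minimal ratio
   q / wvec v at i or at j, where i and j are leaves on the two sides of xy.
   But v has a third branch, containing neither i nor j. *)
Lemma node_ray (v : sd_V G) : (forall x : 'I_n -> R, in_splice_fan G x -> in_splice_fan G' x) ->
  sd_node v -> exists v' : sd_V G', sd_node v' /\
    forall k l, wvec v k * wvec v' l = wvec v l * wvec v' k.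
Proof.
move=> fan nv; have [f [vf _ _]] := node_nbr v v nv.
have [x [y [a [b [xy a0 b0 vE]]]]] :=
  fan_cone HG' (fan _ (cone_fan HG vf (@ler01 R) (lexx 0%R))).
have vE' k : ((wvec v k)%:R = a * (wvec x k)%:R + b * (wvec y k)%:R :> R)%R.
  by rewrite -vE mul1r mul0r addr0.
have vpos k : (0 < a * (wvec x k)%:R + b * (wvec y k)%:R :> R)%R.
  by rewrite -vE' ltr0n wvec_gt0.
have ray (z : sd_V G') (c : R) : (forall k, (wvec v k)%:R = c * (wvec z k)%:R :> R)%R ->
    forall k l, wvec v k * wvec z l = wvec v l * wvec z k.
  move=> zE k l; apply/eqP; rewrite -(eqr_nat R) !natrM !zE; apply/eqP; ring.
have node := cone_node_coeff HG' xy a0 b0 vpos.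
have [b1|b1] := eqVneq b 0%R.
  exists x; split; last by apply: (ray x a) => k; rewrite vE' b1 mul0r addr0.
  by case: node => -[] //; rewrite b1 ltxx.
have [a1|a1] := eqVneq a 0%R.
  exists y; split; last by apply: (ray y b) => k; rewrite vE' a1 mul0r add0r.
  by case: node => -[] //; rewrite a1 ltxx.
have yx : sd_E G' y x by rewrite (adj_sym HG').
have [i bi] := branch_nonempty HG' yx; have [j bj] := branch_nonempty HG' xy.
have [vi vvi bvi] := node_hop HG i nv; have [vj vvj bvj] := node_hop HG j nv.
(* The branches of [i] and [j] at [v] may coincide; [e] avoids both. *)
have [e [ve ei ej]] := node_nbr vi vj nv.
have nbi : ~~ big_ratio v e i.
  rewrite (big_ratio_adj HG Hdet) //; apply: contra ei => bi'.
  by rewrite (branch_uniq ve vvi bi' bvi).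
have nbj : ~~ big_ratio v e j.
  rewrite (big_ratio_adj HG Hdet) //; apply: contra ej => bj'.
  by rewrite (branch_uniq ve vvj bj' bvj).
(* The point [wvec v + wvec e] has positive coordinates even when [e] is a leaf. *)
have [x' [y' [a' [b' [xy' a0' b0' qE]]]]] :=
  fan_cone HG' (fan _ (cone_fan HG ve (@ler01 R) (@ler01 R))).
have qE' k : (a' * (wvec x' k)%:R + b' * (wvec y' k)%:R = (wvec v k + wvec e k)%:R :> R)%R.
  by rewrite -qE !mul1r natrD.
have qpos k : (0 < a' * (wvec x' k)%:R + b' * (wvec y' k)%:R :> R)%R.
  by rewrite qE' ltr0n addn_gt0 wvec_gt0.
have eqij : wvec e i * wvec v j = wvec e j * wvec v i.
  apply/eqP; rewrite eqn_leq; apply/andP; split; rewrite leqNgt.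
    by apply: contra nbi => lt; apply/existsP; exists j.
  by apply: contra nbj => lt; apply/existsP; exists i.
have a2 : (0 < a)%R by rewrite lt_neqAle eq_sym a1.
have b2 : (0 < b)%R by rewrite lt_neqAle eq_sym b1.
have prop := cone_cross Hdet' xy bi bj xy' a2 b2 a0' b0' qpos.
(* A leaf [l] in the branch of [e] has a non-minimal ratio, which refutes the proportionality given
   by [prop]. *)
have [l bl] := branch_nonempty HG ve.
have /existsP[k lt] : big_ratio v e l by rewrite (big_ratio_adj HG Hdet).
have prem : wvec v j * (wvec v i + wvec e i) = (wvec v j + wvec e j) * wvec v i.
  by rewrite mulnDr mulnDl -eqij [wvec e i * _]mulnC.
have concl : wvec e k * wvec v l = wvec e l * wvec v k; last by rewrite concl ltnn in lt.
apply/(@addnI (wvec v k * wvec v l)); rewrite -mulnDl [wvec v k * _]mulnC -mulnDl.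
apply/eqP; rewrite -(eqr_nat R) !natrM -!qE' !vE'; apply/eqP/prop.
by rewrite -!vE' !qE' -!natrM prem.
Qed.

Lemma vertex_ray (v : sd_V G) : (forall x : 'I_n -> R, in_splice_fan G x -> in_splice_fan G' x) ->
  exists v' : sd_V G', wvec v' =1 wvec v.
Proof.
move=> fan; have [nv|[i ->]] := vertex_cases HG v; last first.
  by exists (sd_lab G' i) => j; rewrite !wvec_lab.
have [v' [nv' prop]] := node_ray fan nv; exists v' => i.
by apply/esym/primitive_ray => //; apply: wvec_primitive.
Qed.

(** * The bijection matching the vectors is an isomorphism *)

Variables (phi : sd_V G -> sd_V G') (psi : sd_V G' -> sd_V G).
Hypotheses (phiK : cancel phi psi) (psiK : cancel psi phi).
Hypothesis phi_wvec : forall v : sd_V G, wvec (phi v) =1 wvec v.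

Lemma phi_node (v : sd_V G) : sd_node (phi v) = sd_node v.
Proof.
rewrite (node_wvec HG) (node_wvec HG').
by apply: eq_forallb => i; rewrite phi_wvec.
Qed.

Lemma phi_big_ratio (v u : sd_V G) : big_ratio (phi v) (phi u) =1 big_ratio v u.
Proof. by move=> i; apply: eq_existsb => j; rewrite !phi_wvec. Qed.

Lemma phi_lab i : phi (sd_lab G i) = sd_lab G' i.
Proof. by apply: (wvec_inj HG' Hdet') => j; rewrite phi_wvec !wvec_lab. Qed.

(** Were the first step from [phi v] towards the leaf a node, its preimage would lie in the branch
    of [v] consisting of that leaf alone, making the leaf an interior vertex of a path. *)
Lemma phi_adj_leaf (v : sd_V G) i : sd_node v -> sd_E G v (sd_lab G i) ->
  sd_E G' (phi v) (sd_lab G' i).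
Proof.
move=> nv vi; have nv' : sd_node (phi v) by rewrite phi_node.
have [e' ve' bi'] := node_hop HG' i nv'.
have [<- //|ei'] := eqVneq e' (sd_lab G' i).
have ne' := hop_node ve' (eqP bi') ei'.
have := big_ratio_adj HG' Hdet' nv' ve' i; rewrite bi' -(psiK e') phi_big_ratio => bi.
have nu : sd_node (psi e') by rewrite -phi_node psiK.
have vu : v != psi e'.
  by apply/eqP => vu; move: ve'; rewrite vu psiK (adj_irr HG').
have [e ve de] := hop_ex (splice_connected HG) vu.
have be : branch HG v e i.
  by rewrite -(big_ratioE Hdet nv ve de (or_introl nu)).
have bl : branch HG v (sd_lab G i) i by rewrite branch_leaf.
have el := branch_uniq ve vi be bl; subst e.
have lu : sd_lab G i != psi e' by apply: contraTneq nu => <-; rewrite (lab_not_node HG).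
by have := hop_node vi de lu; rewrite (lab_not_node HG).
Qed.
(** Let [w'] be the first step from [phi u] to [phi v], and suppose it is not [phi v]. At its
    preimage [u] and [v] lie in one branch, being adjacent; [big_ratio] carries this back to [w'],
    which separates their images. *)
Lemma phi_adj_node (u v : sd_V G) : sd_node u -> sd_node v -> sd_E G u v ->
  sd_E G' (phi u) (phi v).
Proof.
move=> nu nv uv; have uv' : phi u != phi v.
  by apply: contraTneq uv => /(can_inj phiK) ->; rewrite (adj_irr HG).
have [w' uw' dw'] := hop_ex (splice_connected HG') uv'.
have [<- //|wv'] := eqVneq w' (phi v).
have wu' : w' != phi u by apply: contraTneq uw' => ->; rewrite (adj_irr HG').
have nw' := hop_node uw' dw' wv'.
have nw : sd_node (psi w') by rewrite -phi_node psiK.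
have wu : psi w' != u by rewrite -(can_eq phiK) psiK.
have wv : psi w' != v by rewrite -(can_eq phiK) psiK.
have [e [we eu ev]] := common_hop HG uv wu wv.
have wu'E : sd_E G' w' (phi u) by rewrite (adj_sym HG').
have [f' wf' df'] := hop_ex (splice_connected HG') wv'.
have nv' : sd_node (phi v) by rewrite phi_node.
have [i bi] := branch_nonempty HG' wu'E.
have bi' : branch HG' w' f' i.
  rewrite -(big_ratioE Hdet' nw' wf' df' (or_introl nv')) -(psiK w') phi_big_ratio.
  rewrite (big_ratioE Hdet nw we ev (or_introl nv)).
  rewrite -(big_ratioE Hdet nw we eu (or_introl nu)) -phi_big_ratio psiK.
  by rewrite (big_ratio_adj HG' Hdet' nw' wu'E).
have uf := branch_uniq wu'E wf' bi bi'; subst f'.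
by move/eqP: dw'; rewrite df' ltn_eqF // leqW.
Qed.

Lemma phi_adj (u v : sd_V G) : sd_E G u v -> sd_E G' (phi u) (phi v).
Proof.
move=> uv; have vu : sd_E G v u by rewrite (adj_sym HG).
have [nu|[i ui]] := vertex_cases HG u; last first.
  have nv : sd_node v by apply: (leaf_adj_node HG (i := i)); rewrite -ui.
  by rewrite (adj_sym HG') ui phi_lab; apply: phi_adj_leaf => //; rewrite -ui.
have [nv|[i vi]] := vertex_cases HG v; first exact: phi_adj_node.
by rewrite vi phi_lab; apply: phi_adj_leaf => //; rewrite -vi.
Qed.

(** The gcd in [weight_gcd] runs over the complement of a branch, which is a [big_ratio] set and so
    preserved by [phi]. *)
Lemma phi_weight (v u : sd_V G) : sd_node v -> sd_E G v u ->
  sd_d G' (phi v) (phi u) = sd_d G v u.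
Proof.
move=> nv vu; have vu' := phi_adj vu; have nv' : sd_node (phi v) by rewrite phi_node.
rewrite -(weight_gcd HG Hco nv vu) -(weight_gcd HG' Hco' nv' vu').
apply: eq_big => [i|i _]; last exact: phi_wvec.
by rewrite -(big_ratio_adj HG' Hdet') // -(big_ratio_adj HG Hdet) // phi_big_ratio.
Qed.

End Comparison.

Theorem theorem8p3 (R : realType) (n : nat) (G G' : splice_diagram n) :
  is_splice_diagram G -> sd_coprime G -> sd_edge_det G -> sd_semigroup G ->
  is_splice_diagram G' -> sd_coprime G' -> sd_edge_det G' -> sd_semigroup G' ->
  all_trop_mult_one R G -> all_trop_mult_one R G' ->
  (forall x : 'I_n -> R, in_splice_fan G x <-> in_splice_fan G' x) ->
  splice_iso G G'.
Proof.
move=> HG Hco Hdet _ HG' Hco' Hdet' _ _ _ fan.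
have [phi phiE] := fin_all_exists (fun v : sd_V G =>
  vertex_ray HG Hdet Hco HG' Hdet' Hco' v (fun x => proj1 (fan x))).
have [psi psiE] := fin_all_exists (fun v : sd_V G' =>
  vertex_ray HG' Hdet' Hco' HG Hdet Hco v (fun x => proj2 (fan x))).
have phiK : cancel phi psi.
  by move=> v; apply: (wvec_inj HG Hdet) => i; rewrite psiE phiE.
have psiK : cancel psi phi.
  by move=> v; apply: (wvec_inj HG' Hdet') => i; rewrite phiE psiE.
exists phi; split.
- by exists psi.
(* Adjacency is reflected because the inverse [psi] preserves it as well. *)
- move=> x y; apply/idP/idP => [xy|]; last exact: phi_adj phiK psiK phiE _ _.
  by have := phi_adj HG' Hdet' HG Hdet psiK phiK psiE xy; rewrite !phiK.
- exact: phi_lab.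
- exact: phi_weight psiK phiE.
Qed.
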